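(* Let $\mathbb F$ be a field of characteristic $0$, let $N\in\mathbb N$, and let $V$ be an irreducible $\mathfrak{sl}_2$-module (over $\mathbb F$) of dimension $N+1$. Then: (i) the following are totally opposite flags on $V$: $$\{\nu_x^{N-i}V\}_{i=0}^N,\qquad \{\nu_y^{N-i}V\}_{i=0}^N,\qquad \{\nu_z^{N-i}V\}_{i=0}^N;$$ (ii) for the corresponding Billiard Array on $V$, the value of each white 3-clique is $1$.
   Context: $\mathfrak{sl}_2$ denotes the Lie algebra over $\mathbb F$ with basis $x,y,z$ (the equitable basis) and Lie bracket $[x,y]=2x+2y$, $[y,z]=2y+2z$, $[z,x]=2z+2x$. The elements $\nu_x,\nu_y,\nu_z$ of $\mathfrak{sl}_2$ are defined by $-2\nu_x=y+z$, $-2\nu_y=z+x$, $-2\nu_z=x+y$. For a module $V$, $\nu_x^{k}V$ is the image of $V$ under the $k$-th power of the action of $\nu_x$ on $V$ (so $\nu_x^0V=V$), and similarly for $\nu_y,\nu_z$. A flag on $V$ ($\dim V=N+1$) is a sequence $\{U_i\}_{i=0}^N$ of subspaces of $V$ with $\dim U_i=i+1$ for $0\le i\le N$ and $U_{i-1}\subseteq U_i$ for $1\le i\le N$. Three flags $\{U_i\}_{i=0}^N,\{U'_i\}_{i=0}^N,\{U''_i\}_{i=0}^N$ on $V$ are called totally opposite whenever $U_{N-r}\cap U'_{N-s}\cap U''_{N-t}=0$ for all integers $r,s,t$ with $0\le r,s,t\le N$ and $r+s+t>N$. $\mathbb N=\{0,1,2,\ldots\}$. $\Delta_n=\{(r,s,t):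 r,s,t\in\mathbb N,\ r+s+t=n\}$, whose elements are called locations. A line in $\Delta_N$ is a set consisting of all locations whose $\eta$-coordinate equals a fixed number $m$, for some $\eta\in\{1,2,3\}$ and some $0\le m\le N$. Locations $\lambda,\mu$ are adjacent if $\lambda-\mu$ is one of $\pm(1,-1,0),\pm(0,1,-1),\pm(-1,0,1)$. For $N\ge1$, a black 3-clique in $\Delta_N$ is a set $\{(r+1,s,t),(r,s+1,t),(r,s,t+1)\}$ with $(r,s,t)\in\Delta_{N-1}$. Each pair of adjacent locations is contained in a unique black 3-clique. For $N\ge2$, a white 3-clique in $\Delta_N$ is a set $\{(r,s+1,t+1),(r+1,s,t+1),(r+1,s+1,t)\}$ with $(r,s,t)\in\Delta_{N-2}$; for $N\le1$ there are none. Let $\mathcal P_1(V)$ be the set of one-dimensional subspaces of $V$. A Billiard Array on $V$ is a function $B:\Delta_N\to\mathcal P_1(V)$, $\lambda\mapsto B_\lambda$, such that (a) for each line $L$ in $\Delta_N$ the sum $\sum_{\lambda\in L}B_\lambda$ is direct; (b) for each black 3-clique $C$ in $\Delta_N$ the sum $\sum_{\lambda\in C}B_\lambda$ is not direct. The Billiard Array corresponding to three totally opposite flags $\{U_i\},\{U'_i\},\{U''_i\}$ (in this order) is $B_{(r,s,t)}=U_{N-r}\cap U'_{N-s}\cap U''_{N-t}$ for $(r,s,t)\in\Delta_N$; it is indeed a Billiard Array. For adjacent $\lambda,\mu\in\Delta_N$, let $\nu$ be the unique location such that $\lambda,\mu,\nu$ form a black 3-clique. For each nonzero $u\in B_\lambda$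 there is a unique nonzero $v\in B_\mu$ with $u+v\in B_\nu$; the $\mathbb F$-linear bijection $\tilde B_{\lambda,\mu}:B_\lambda\to B_\mu$ sends $u\mapsto v$. For a white 3-clique $\lambda=(r,s+1,t+1)$, $\mu=(r+1,s,t+1)$, $\nu=(r+1,s+1,t)$, the composition $\tilde B_{\nu,\lambda}\circ\tilde B_{\mu,\nu}\circ\tilde B_{\lambda,\mu}:B_\lambda\to B_\lambda$ is a nonzero scalar multiple of the identity; this scalar is the value ($B$-value) of the white 3-clique. *)

(* Defs.v *)
From mathcomp Require Import all_boot all_order all_algebra.
From Stdlib Require Import ClassicalEpsilon.
From mathcomp Require Import ring.
Set Implicit Arguments.
Unset Strict Implicit.
Unset Printing Implicit Defensive.
Import GRing.Theory.
Local Open Scope ring_scope.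

(* sl_2 in coordinates with respect to its equitable basis x, y, z. *)

Definition sl2 (F : fieldType) : Type := 'rV[F]_3.

Section Sl2.
Variable F : fieldType.
Implicit Types a b c : sl2 F.

Definition sl2_x : sl2 F := delta_mx 0 0.
Definition sl2_y : sl2 F := delta_mx 0 1.
Definition sl2_z : sl2 F := delta_mx 0 2.

(* The alternating bilinear extension of
   [x,y] = 2x + 2y, [y,z] = 2y + 2z, [z,x] = 2z + 2x. *)
Definition sl2_bracket a b : sl2 F :=
    (a 0 0 * b 0 1 - a 0 1 * b 0 0) *: (2 *: sl2_x + 2 *: sl2_y)
  + (a 0 1 * b 0 2 - a 0 2 * b 0 1) *: (2 *: sl2_y + 2 *: sl2_z)
  + (a 0 2 * b 0 0 - a 0 0 * b 0 2) *: (2 *: sl2_z + 2 *: sl2_x).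

Lemma sl2_bracket_xy : sl2_bracket sl2_x sl2_y = 2 *: sl2_x + 2 *: sl2_y.
Proof. by apply/rowP => i; rewrite !mxE /=; ring. Qed.

Lemma sl2_bracket_yz : sl2_bracket sl2_y sl2_z = 2 *: sl2_y + 2 *: sl2_z.
Proof. by apply/rowP => i; rewrite !mxE /=; ring. Qed.

Lemma sl2_bracket_zx : sl2_bracket sl2_z sl2_x = 2 *: sl2_z + 2 *: sl2_x.
Proof. by apply/rowP => i; rewrite !mxE /=; ring. Qed.

Lemma sl2_bracket_linear b k a c :
  sl2_bracket (k *: a + c) b = k *: sl2_bracket a b + sl2_bracket c b.
Proof. by apply/rowP => i; rewrite !mxE /=; ring. Qed.

Lemma sl2_bracket_alt a : sl2_bracket a a = 0.
Proof. by apply/rowP => i; rewrite !mxE /=; ring. Qed.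

Lemma sl2_bracket_jacobi a b c :
  sl2_bracket a (sl2_bracket b c) + sl2_bracket b (sl2_bracket c a)
  + sl2_bracket c (sl2_bracket a b) = 0.
Proof.
apply/rowP => i; rewrite !mxE /=.
by case: i => [[|[|[|//]]]] Hi; rewrite /=; ring.
Qed.

(* The factor 2 is invertible in the intended characteristic 0. *)
Definition nu_x : sl2 F := (- 2)^-1 *: (sl2_y + sl2_z).
Definition nu_y : sl2 F := (- 2)^-1 *: (sl2_z + sl2_x).
Definition nu_z : sl2 F := (- 2)^-1 *: (sl2_x + sl2_y).

End Sl2.
Arguments sl2_x {F}.
Arguments sl2_y {F}.
Arguments sl2_z {F}.
Arguments nu_x {F}.
Arguments nu_y {F}.
Arguments nu_z {F}.

Section Modules.
Variables (F : fieldType) (V : vectType F).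

Definition sl2_module (rho : {linear sl2 F -> 'End(V)}) : Prop :=
  forall a b, rho (sl2_bracket a b) = (rho a \o rho b)%VF - (rho b \o rho a)%VF.

Definition sl2_irreducible (rho : {linear sl2 F -> 'End(V)}) : Prop :=
  {:V}%VS <> 0%VS /\
  forall W : {vspace V},
    (forall a, (rho a @: W <= W)%VS) -> W = 0%VS \/ W = {:V}%VS.

Definition lfun_pow (f : 'End(V)) (k : nat) : 'End(V) :=
  iter k (fun g => f \o g)%VF \1%VF.

Definition pow_image_seq (N : nat) (f : 'End(V)) : 'I_N.+1 -> {vspace V} :=
  fun i => limg (lfun_pow f (N - i)).

End Modules.
Arguments pow_image_seq {F V} N f _.

Section Flags.
Variables (F : fieldType) (V : vectType F) (N : nat).
Implicit Types U : 'I_N.+1 -> {vspace V}.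

Definition is_flag U : Prop :=
  (forall i, \dim (U i) = i.+1) /\
  (forall i j : 'I_N.+1, j = i.+1 :> nat -> (U i <= U j)%VS).

(* [rev_ord r] is the index N - r. *)
Definition totally_opposite U U' U'' : Prop :=
  forall r s t : 'I_N.+1, (N < r + s + t)%N ->
    (U (rev_ord r) :&: U' (rev_ord s) :&: U'' (rev_ord t))%VS = 0%VS.

End Flags.

Definition location (N : nat) : Type :=
  {p : 'I_N.+1 * 'I_N.+1 * 'I_N.+1 | (p.1.1 + p.1.2 + p.2 == N)%N}.

Section Locations.
Variable N : nat.
Implicit Types (l m n : location N) (C : {set location N}).

Definition loc1 l : 'I_N.+1 := (val l).1.1.
Definition loc2 l : 'I_N.+1 := (val l).1.2.
Definition loc3 l : 'I_N.+1 := (val l).2.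

Definition at_loc l (r s t : nat) : Prop :=
  [/\ loc1 l = r :> nat, loc2 l = s :> nat & loc3 l = t :> nat].

Definition is_line C : Prop :=
  exists k : 'I_N.+1,
    [\/ C = [set l | loc1 l == k],
        C = [set l | loc2 l == k]
      | C = [set l | loc3 l == k]].

Definition black_clique C : Prop :=
  exists l m n, C = [set l; m; n] /\
    exists r s t, [/\ at_loc l r.+1 s t, at_loc m r s.+1 t & at_loc n r s t.+1].

(* The vertices are ordered, since the value is read off by going around
   the clique in this order. *)
Definition white_clique l m n : Prop :=
  exists r s t,
    [/\ at_loc l r s.+1 t.+1, at_loc m r.+1 s t.+1 & at_loc n r.+1 s.+1 t].

End Locations.

Section BilliardArrays.
Variables (F : fieldType) (V : vectType F) (N : nat).
Implicit Types (B : location N -> {vspace V}) (l m n : location N).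

Definition billiard_array B : Prop :=
  [/\ forall l, \dim (B l) = 1%N,
      forall L, is_line L -> directv (\sum_(l in L) B l)%VS
    & forall C, black_clique C -> ~~ directv (\sum_(l in C) B l)%VS].

Definition array_of_flags (U U' U'' : 'I_N.+1 -> {vspace V}) :
    location N -> {vspace V} :=
  fun l => (U (rev_ord (loc1 l)) :&: U' (rev_ord (loc2 l))
            :&: U'' (rev_ord (loc3 l)))%VS.

Definition tilde_spec B l m (f : 'Hom(subvs_of (B l), subvs_of (B m))) : Prop :=
  exists2 n, black_clique [set l; m; n] &
    forall u, u != 0 -> f u != 0 /\ vsval u + vsval (f u) \in B n.

(* For a Billiard Array and adjacent l, m, exactly one f satisfies
   [tilde_spec]; elsewhere the value of [epsilon] is irrelevant. *)
Definition tilde B l m : 'Hom(subvs_of (B l), subvs_of (B m)) :=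
  epsilon (inhabits 0) (@tilde_spec B l m).

(* Likewise, the scalar exists and is unique when B is a Billiard Array and
   l, m, n is a white 3-clique. *)
Definition clique_value B l m n : F :=
  epsilon (inhabits 0) (fun a : F =>
    (tilde B n l \o tilde B m n \o tilde B l m)%VF = a *: \1%VF).

End BilliardArrays.

(* Main.v *)
Require Import Defs.
From mathcomp Require Import all_boot all_order all_algebra.
From HB Require Import structures.
From mathcomp Require Import ring zify.
From Stdlib Require Import ClassicalEpsilon.
Set Implicit Arguments.
Unset Strict Implicit.
Unset Printing Implicit Defensive.
Import GRing.Theory.
Local Open Scope ring_scope.

(** The irreducible module of dimension N + 1 is the space of binary forms of
    degree N. Choose linear forms x, y, z in two variables with x + y + z = 0.
    The operators nu_x, nu_y, nu_z act as derivations: nu_x kills x and sends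
    every form to a multiple of x, and similarly for the others. Hence
    nu_x^k V consists of the forms divisible by x^k, and likewise for y and z.
    Everything follows from this.

    - A form divisible by x^r, y^s and z^t with r + s + t > N vanishes, since
      x, y, z are pairwise coprime: the flags are totally opposite.
    - For r + s + t = N the space B_(r,s,t) is spanned by x^r y^s z^t.
    - The three monomials of a black clique are x m, y m, z m for a monomial m
      of degree N - 1, and they sum to zero. So the transition map between two
      of them sends monomial to monomial, and going around a white clique
      returns to the starting monomial: the value is 1.

    The forms are dehomogenized here by x = X, y = 1, z = - (X + 1), so that
    divisibility by y^s becomes a bound on the degree.

    Most of the work is the identification of the module with binary forms
    ([exists_polynomial_model]). Over an arbitrary field of characteristic 0
    eigenvectors do not come for free, so weight vectors are found through
    nilpotency: an operator f with [g, f] = c f, c nonzero, is nilpotent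
    ([nilpotent_of_commutator]), which yields a weight vector killed by nu_y
    ([exists_weight_vector]). Its images under the powers of nu_x span V and
    correspond to the monomials X^i. That the sums along the lines are direct
    and that the cells have dimension 1 holds for all totally opposite flags
    ([cell_line], [dim_cell]). *)

(** * Powers of an endomorphism *)

(** Linear functionals separate points, so an identity between linear
    combinations of vectors may be checked after applying an arbitrary
    functional, where it becomes an identity in the field. *)
Lemma functional_ext (F : fieldType) (V : vectType F) (u v : V) :
    (forall phi : V -> F,
       [/\ {morph phi : a b / a + b}, {morph phi : a / - a}, phi 0 = 0 &
           forall k a, phi (k *: a) = k * phi a] -> phi u = phi v) ->
  u = v.
Proof.
move=> eq_phi; rewrite (coord_vbasis (memvf u)) (coord_vbasis (memvf v)).
apply: eq_bigr => i _; congr (_ *: _); apply: eq_phi; split.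
- exact: linearD.
- exact: linearN.
- exact: linear0.
- by move=> k a; rewrite linearZ.
Qed.

(** Decides identities between linear combinations of vectors whose
    coefficients agree as field expressions. *)
Ltac vring :=
  let phi := fresh in let phiD := fresh in let phiN := fresh in
  let phi0 := fresh in let phiZ := fresh in
  apply: functional_ext => phi [phiD phiN phi0 phiZ];
  rewrite ?(phiD, phiN, phi0, phiZ); ring.

Section Powers.
Variables (F : fieldType) (V : vectType F).
Implicit Types (f g : 'End(V)) (u : V).

Lemma lfun_pow0 f u : lfun_pow f 0 u = u.
Proof. by rewrite /lfun_pow /= id_lfunE. Qed.

Lemma lfun_powS f k u : lfun_pow f k.+1 u = f (lfun_pow f k u).
Proof. by rewrite /lfun_pow /= comp_lfunE. Qed.

Lemma lfun_powD f j k u : lfun_pow f (j + k) u = lfun_pow f j (lfun_pow f k u).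
Proof. by elim: j => [|j IHj]; rewrite ?lfun_pow0 // addSn !lfun_powS IHj. Qed.

Lemma limg_powS f k : limg (lfun_pow f k.+1) = (f @: limg (lfun_pow f k))%VS.
Proof. by rewrite -limg_comp. Qed.

Lemma limg_pow_leq f j k : (j <= k)%N -> (limg (lfun_pow f k) <= limg (lfun_pow f j))%VS.
Proof.
move=> /subnKC <-; apply/subvP => _ /memv_imgP[u _ ->].
by rewrite lfun_powD memv_img ?memvf.
Qed.

(** The images of the powers of f shrink strictly until they vanish, since a
    repeated image would repeat forever. If the first vanishing power is the
    (dim V)-th one, there is room for a drop of exactly one at each step. *)
Lemma dim_limg_pow f n (dimV : \dim {:V} = n.+1) :
    lfun_pow f n.+1 = 0 -> lfun_pow f n != 0 ->
  forall k, (k <= n.+1)%N -> \dim (limg (lfun_pow f k)) = (n.+1 - k)%N.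
Proof.
move=> f_nil f_n; pose d k := \dim (limg (lfun_pow f k)).
have d_decr k : (k <= n)%N -> (d k.+1 < d k)%N.
  move=> le_kn; rewrite ltn_neqAle dimvS ?limg_pow_leq // andbT.
  apply: contraNN f_n => eq_d.
  have stab : (f @: limg (lfun_pow f k))%VS = limg (lfun_pow f k).
    by apply/eqP; rewrite -limg_powS eqEdim limg_pow_leq //= [X in (_ <= X)%N](eqP eq_d).
  have stab_j j : limg (lfun_pow f (k + j)) = limg (lfun_pow f k).
    by elim: j => [|j IHj]; rewrite ?addn0 // addnS limg_powS IHj.
  apply/eqP/lfunP => u; rewrite zero_lfunE; apply/eqP.
  have := stab_j (n - k)%N; have := stab_j (n.+1 - k)%N.
  rewrite !subnKC ?(leqW le_kn) // => <- eq_n.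
  have := memv_img (lfun_pow f n) (memvf u).
  by rewrite eq_n f_nil => /memv_imgP[w _ ->]; rewrite zero_lfunE.
have d0 : d 0%N = n.+1 by rewrite -dimV /d (_ : lfun_pow f 0 = \1%VF) // lim1g.
(* At most n.+1 - k, by counting the drops from the top. *)
have up k : (k <= n.+1)%N -> (d k + k <= n.+1)%N.
  elim: k => [|k IHk] le_k; first by rewrite d0 addn0.
  by have := IHk (ltnW le_k); have := d_decr k le_k; lia.
(* At least n.+1 - k, by counting the drops from the bottom. *)
have down j : (j <= n.+1)%N -> (j <= d (n.+1 - j))%N.
  elim: j => [//|j IHj] le_j.
  have := IHj (ltnW le_j); have := d_decr (n.+1 - j.+1)%N.
  by rewrite (_ : (n.+1 - j.+1).+1 = n.+1 - j)%N; lia.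
move=> k le_k; apply/eqP; rewrite -/(d k) eqn_leq; apply/andP; split.
  by have := up k le_k; lia.
by have := down (n.+1 - k)%N (leq_subr _ _); rewrite subKn.
Qed.

Hypothesis charF0 : [pchar F] =i pred0.

Lemma natf_eq0 n : (n%:R == 0 :> F) = (n == 0)%N.
Proof. exact: (pcharf0P F).1. Qed.

Lemma commutator_pow f g (c : F) :
    (forall u, g (f u) - f (g u) = c *: f u) ->
  forall k u, g (lfun_pow f k u) - lfun_pow f k (g u) = (c *+ k) *: lfun_pow f k u.
Proof.
move=> gf; elim=> [|k IHk] u; first by rewrite !lfun_pow0 subrr mulr0n scale0r.
move/eqP: (gf (lfun_pow f k u)); rewrite subr_eq => /eqP gf_k.
move/eqP: (IHk u); rewrite subr_eq => /eqP IH.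
rewrite !lfun_powS gf_k IH !linearD linearZ /=; vring.
Qed.

(** The powers of f are eigenvectors of the commutator with g, for the
    eigenvalues k * c. In characteristic 0 these are distinct, so the nonzero
    powers are linearly independent, and End(V) has room for finitely many. *)
Lemma nilpotent_of_commutator f g (c : F) :
    c != 0 -> (forall u, g (f u) - f (g u) = c *: f u) ->
  exists k, lfun_pow f k = 0.
Proof.
move=> c0 gf; pose m := \dim {:'End(V)}.
have [/existsP[k /eqP fk0] | no_k] := boolP [exists k : 'I_m.+1, lfun_pow f k == 0].
  by exists k.
pose X := [tuple lfun_pow f i | i < m.+1].
suff freeX : free X.
  have := dimvS (subvf <<X>>); rewrite (eqnP freeX) size_tuple ltnn //.
suff indep n (a : nat -> F) : (n <= m.+1)%N ->
    (forall u, \sum_(i < n) a i *: lfun_pow f i u = 0) -> forall i, (i < n)%N -> a i = 0.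
  apply/freeP => a a0 i; have := @indep m.+1 (fun j => a (inord j)) (leqnn _).
  move=> /(_ _ i (ltn_ord i)); rewrite inord_val; apply => u.
  move/lfunP/(_ u): a0; rewrite sum_lfunE zero_lfunE => a0u; rewrite -[RHS]a0u.
  by apply: eq_bigr => j _; rewrite inord_val scale_lfunE (nth_mktuple _ _ j).
elim: n a => [//|n IHn] a lt_nm a0.
(* Subtracting the commutator with g from n * c times the relation kills
   the top term and multiplies the others by nonzero scalars. *)
have a_lt i : (i < n)%N -> a i = 0.
  move=> lt_in; suff /eqP : a i * (c *+ (n - i)) = 0.
    rewrite mulf_eq0 -mulr_natr mulf_eq0 (negPf c0).
    by rewrite natf_eq0 subn_eq0 leqNgt lt_in orbF => /eqP.
  apply: (IHn (fun j => a j * (c *+ (n - j))) (ltnW lt_nm)) lt_in => u.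
  have := congr1 g (a0 u); rewrite linear0 linear_sum => g0.
  have : \sum_(j < n.+1) ((c *+ n) *: (a j *: lfun_pow f j u)
           - (a j *: g (lfun_pow f j u) - a j *: lfun_pow f j (g u))) = 0.
    rewrite !sumrB -scaler_sumr !a0 scaler0 subr0 sub0r -[RHS]oppr0; congr (- _).
    by rewrite -[RHS]g0; apply: eq_bigr => j _; rewrite linearZ.
  rewrite big_ord_recr /= => rel; rewrite -[RHS]rel.
  rewrite -scalerBr (commutator_pow gf) [X in _ = _ + X](_ : _ = 0) ?addr0; last by vring.
  apply: eq_bigr => j _; rewrite -scalerBr (commutator_pow gf) mulrnBr ?(ltnW (ltn_ord j)) //; vring.
move=> i; rewrite ltnS leq_eqVlt => /predU1P[-> | /a_lt //].
apply: contraNeq no_k => an0; apply/existsP; exists (Ordinal lt_nm).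
apply/eqP/lfunP => u; apply/eqP; rewrite zero_lfunE.
have := a0 u; rewrite big_ord_recr big1 /= => [|j _]; last by rewrite a_lt ?scale0r.
by rewrite add0r => /eqP; rewrite scaler_eq0 (negPf an0).
Qed.

End Powers.

(** * Equitable triples and their weight vectors *)

Section Triples.
Variables (F : fieldType) (V : vectType F).
Implicit Types (A B C : 'End(V)) (u v : V).

(** The relations satisfied by nu_x, nu_y, nu_z acting on a module. The right
    hand sides are the actions of z, x and y, so that, up to signs, any two of
    the three operators together with their commutator form a standard
    sl_2-triple. *)
Definition equitable_triple A B C : Prop :=
  forall u, [/\ A (B u) - B (A u) = C u - A u - B u,
                B (C u) - C (B u) = A u - B u - C u
              & C (A u) - A (C u) = B u - C u - A u].

Definition no_invariant_subspace A B : Prop :=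
  forall W : {vspace V}, (A @: W <= W)%VS -> (B @: W <= W)%VS ->
  W = 0%VS \/ W = {:V}%VS.

Variables A B C : 'End(V).
Hypothesis charF0 : [pchar F] =i pred0.
Hypothesis triABC : equitable_triple A B C.

(** The action of z, equal to the commutator of A and B. Its eigenvalues are
    the weights, which A and B shift by -2 and 2. *)
Definition weight_op : 'End(V) := C - A - B.
Local Notation H := weight_op.

Lemma weight_opE u : H u = C u - A u - B u.
Proof. by rewrite /weight_op !add_lfunE !opp_lfunE. Qed.

Lemma weight_op_comm u : A (B u) = B (A u) + H u.
Proof. by rewrite weight_opE; have [<- _ _] := triABC u; vring. Qed.

Lemma weight_op_A u : H (A u) - A (H u) = (-2) *: A u.
Proof.
rewrite !weight_opE !(linearD, linearN) /=; have [AB _ CA] := triABC u.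
transitivity ((C (A u) - A (C u)) + (A (B u) - B (A u))); first by vring.
by rewrite AB CA; vring.
Qed.

Lemma weight_op_B u : H (B u) - B (H u) = 2 *: B u.
Proof.
rewrite !weight_opE !(linearD, linearN) /=; have [AB BC _] := triABC u.
transitivity (- (B (C u) - C (B u)) - (A (B u) - B (A u))); first by vring.
by rewrite AB BC; vring.
Qed.

(** The standard commutation of one nilpotent generator of sl_2 past a power
    of the opposite one. *)
Lemma lowering_pow n u :
  B (lfun_pow A n.+1 u) =
  lfun_pow A n.+1 (B u) - n.+1%:R *: lfun_pow A n (H u - n%:R *: u).
Proof.
elim: n u => [|n IHn] u.
  by rewrite !lfun_powS !lfun_pow0 weight_op_comm; vring.
have BA : B (lfun_pow A n.+2 u) = A (B (lfun_pow A n.+1 u)) - H (lfun_pow A n.+1 u).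
  by rewrite weight_op_comm lfun_powS; vring.
rewrite BA IHn.
move/eqP: (commutator_pow weight_op_A n.+1 u); rewrite subr_eq => /eqP ->.
rewrite !lfun_powS !(linearD, linearN, linearZ) /=.
vring.
Qed.

(** The kernel of B is nonzero because B is nilpotent; it is stable under H.
    For u in it, [lowering_pow] shows that A^(n+1) u = 0 forces
    A^n (H - n) u = 0. Starting from a vanishing power of A, replacing u by
    (H - n) u as long as this is nonzero must therefore stop, and it stops at
    an eigenvector of H. *)
Lemma exists_weight_vector : {:V}%VS <> 0%VS ->
  exists v c, [/\ v != 0, B v = 0 & H v = c *: v].
Proof.
move=> V0.
have ch2 : 2 != 0 :> F by rewrite (natf_eq0 charF0).
have [a Aa] : exists a, lfun_pow A a = 0.
  by apply: (nilpotent_of_commutator charF0 _ weight_op_A); rewrite oppr_eq0.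
have [b Bb] : exists b, lfun_pow B b = 0.
  by apply: (nilpotent_of_commutator charF0 _ weight_op_B).
have [u u0 Bu] : exists2 u, u != 0 & B u = 0.
  have u0 : vpick {:V} != 0 by rewrite vpick0; apply/eqP.
  have ex_b : exists b, lfun_pow B b (vpick {:V}) == 0.
    by exists b; rewrite Bb zero_lfunE.
  case: (ex_minnP ex_b) => -[|m] Bm min_m; first by rewrite lfun_pow0 (negPf u0) in Bm.
  exists (lfun_pow B m (vpick {:V})); last by apply/eqP; rewrite -lfun_powS.
  by apply/negP => /min_m; rewrite ltnn.
have : lfun_pow A a u = 0 by rewrite Aa zero_lfunE.
elim: a {Aa} u u0 Bu => [|a IHa] u u0 Bu Au.
  by rewrite lfun_pow0 in Au; rewrite Au eqxx in u0.
have [w0 | w0] := eqVneq (H u - a%:R *: u) 0.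
  by exists u, a%:R; split=> //; apply/eqP; rewrite -subr_eq0 w0.
apply: (IHa _ w0).
  rewrite linearD linearN linearZ /= Bu scaler0 subr0.
  have := weight_op_B u; rewrite Bu linear0 sub0r scaler0 => /eqP.
  by rewrite oppr_eq0 => /eqP.
have := lowering_pow a u; rewrite Au Bu !linear0 sub0r => /eqP.
by rewrite eq_sym oppr_eq0 scaler_eq0 (natf_eq0 charF0) => /eqP.
Qed.

End Triples.

(** * The polynomial model of an irreducible module *)

Section PolyComb.
Variables (F : fieldType) (V : vectType F).

Definition poly_comb (n : nat) (w : nat -> V) (p : {poly F}) : V :=
  \sum_(i < n) p`_i *: w i.

Fact poly_comb_linear n w : linear (poly_comb n w).
Proof.
move=> k p q; rewrite /poly_comb scaler_sumr -big_split /=.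
by apply: eq_bigr => i _; rewrite coefD coefZ; vring.
Qed.

HB.instance Definition _ n w :=
  GRing.isLinear.Build F {poly F} V _ (poly_comb n w) (poly_comb_linear n w).

End PolyComb.

Section Raise.
Variable F : fieldType.
Implicit Types p l : {poly F}.

(** The derivation of the binary forms of degree N that sends l to 0 and y to
    l, dehomogenized by y = 1: Euler's relation turns the derivative along y
    into p *+ N - l * p^`(). *)
Definition raise_poly N l p : {poly F} := l * (p *+ N - l * p^`()).

(** The degree does not rise above N, as the coefficients of degree N of p *+ N
    and 'X * p^`() agree. *)
Lemma size_raise_poly N (a : F) p :
  (size p <= N.+1)%N -> (size (raise_poly N ('X - a%:P) p) <= N.+1)%N.
Proof.
move=> sp; apply: leq_trans (size_polyMleq _ _) _; rewrite size_XsubC /=.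
rewrite addnC addn1 ltnS; apply/leq_sizeP => j le_Nj.
rewrite mulrBl mul_polyC !coefB coefMn coefZ coefXM !coef_deriv.
have big k : (N < k)%N -> p`_k = 0 by move=> lt_Nk; rewrite nth_default // (leq_trans sp).
rewrite (big j.+1) // mul0rn mulr0 subr0.
case: j le_Nj => [|j] le_Nj /=; first by move: le_Nj; rewrite leqn0 => /eqP ->; rewrite mulr0n subr0.
move: le_Nj; rewrite leq_eqVlt => /predU1P[<- | lt_Nj]; first by rewrite subrr.
by rewrite big // !mul0rn subr0.
Qed.

Lemma raise_poly_exp N l k : (k <= N)%N -> l^`() = 1 ->
  raise_poly N l (l ^+ k) = (l ^+ k.+1) *+ (N - k).
Proof.
move=> le_kN l1; rewrite /raise_poly deriv_exp l1 mul1r mulrnBr // exprS.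
case: k le_kN => [|k] _; first by rewrite !mulr0n mulr0 !subr0; ring.
by rewrite /= exprS; ring.
Qed.

Lemma raise_poly_dvd N l k p : l ^+ k %| p -> l^`() = 1 -> l ^+ k.+1 %| raise_poly N l p.
Proof.
move=> /Pdiv.Field.dvdpP [q ->] l1; rewrite /raise_poly derivM deriv_exp l1 mul1r.
apply/Pdiv.Field.dvdpP; exists (q *+ N - l * q^`() - q *+ k).
case: k => [|k]; first by rewrite !mulr0n; ring.
by rewrite /= !exprS; ring.
Qed.

End Raise.

(** The polynomials of degree at most N are the binary forms of degree N in
    the linear forms x = X, y = 1, z = - (X + 1), whose sum is zero. There
    A, B and C are the derivations that vanish at x, y and z, and their values
    are multiples of x, y and z. *)
Definition polynomial_model (F : fieldType) (V : vectType F) (N : nat)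
    (A B C : 'End(V)) (phi : {linear {poly F} -> V}) : Prop :=
  [/\ forall p : {poly F}, (size p <= N.+1)%N -> phi p = 0 -> p = 0,
      forall u, exists2 p : {poly F}, (size p <= N.+1)%N & u = phi p
    & forall p : {poly F}, (size p <= N.+1)%N ->
      [/\ A (phi p) = phi (raise_poly N ('X - 0%:P) p),
          B (phi p) = - phi p^`()
        & C (phi p) = phi (raise_poly N ('X - (-1)%:P) p)]].

Section Model.
Variables (F : fieldType) (V : vectType F).
Variables A B C : 'End(V).
Hypothesis charF0 : [pchar F] =i pred0.
Hypothesis triABC : equitable_triple A B C.

(** The vectors A^i v, for a weight vector v killed by B, rescaled so that A and
    B act on w i as X (M - X d/dX) and - d/dX act on 'X^i. *)
Lemma exists_string : {:V}%VS <> 0%VS -> exists w : nat -> V, exists M,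
  [/\ w 0%N != 0, B (w 0%N) = 0,
      forall i, (i <= M)%N -> A (w i) = (M - i)%:R *: w i.+1
    & forall i, (i < M)%N -> B (w i.+1) = - (i.+1%:R *: w i)].
Proof.
move=> V0; have natF0 := natf_eq0 charF0.
have [v [c [v0 Bv Hv]]] := exists_weight_vector charF0 triABC V0.
have [a Aa] : exists a, lfun_pow A a = 0.
  by apply: (nilpotent_of_commutator charF0 _ (weight_op_A triABC)); rewrite oppr_eq0 natF0.
have ex_a : exists a, lfun_pow A a v == 0 by exists a; rewrite Aa zero_lfunE.
case: (ex_minnP ex_a) => -[|M] /eqP AM min_M; first by rewrite lfun_pow0 in AM; rewrite AM eqxx in v0.
have AM0 : lfun_pow A M v != 0 by apply/negP => /min_M; rewrite ltnn.
have BA n : B (lfun_pow A n.+1 v) = - ((n.+1%:R * (c - n%:R)) *: lfun_pow A n v).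
  by rewrite (lowering_pow triABC) Bv linear0 Hv -scalerBl [lfun_pow A n (_ *: _)]linearZ /=; vring.
(* M is the length of the string, and B A^(M+1) v = 0 determines the weight. *)
have cM : c = M%:R.
  have := BA M; rewrite AM linear0 => /esym/eqP.
  by rewrite oppr_eq0 scaler_eq0 (negPf AM0) orbF mulf_eq0 natF0 subr_eq0 => /eqP.
have fact0 n : n`!%:R != 0 :> F by rewrite natF0 -lt0n fact_gt0.
exists (fun i => ((M - i)`!%:R / M`!%:R) *: lfun_pow A i v), M.
split.
- by rewrite lfun_pow0 scaler_eq0 mulf_eq0 invr_eq0 !(negPf (fact0 _)).
- by rewrite lfun_pow0 linearZ /= Bv scaler0.
- move=> i; rewrite leq_eqVlt => /predU1P[-> | lt_iM].
    by rewrite linearZ /= -lfun_powS AM scaler0 subnn scale0r.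
  rewrite linearZ /= -lfun_powS scalerA mulrA -natrM.
  by rewrite -{2}(subnSK lt_iM) -factS subnSK.
- move=> i lt_iM; rewrite linearZ /= BA cM -natrB ?(ltnW lt_iM) //.
  by rewrite -{2}(subnSK lt_iM) factS subnSK // natrM; vring.
Qed.

(** The span of the string is invariant, hence everything. The string is also
    free: the kernel of the model map is stable under derivation, so a nonzero
    polynomial in it would produce a nonzero constant in it, whereas
    1 is sent to w 0, which is nonzero. So the string has N.+1 members. *)
Lemma exists_polynomial_model N : no_invariant_subspace A B ->
  \dim {:V} = N.+1 -> exists phi, polynomial_model N A B C phi.
Proof.
move=> irrAB dimV; have natF0 := natf_eq0 charF0.
have V0 : {:V}%VS <> 0%VS by move=> V0; move: dimV; rewrite V0 dimv0.
have [w [M [w0 Bw0 Aw Bw]]] := exists_string V0.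
pose phi : {linear {poly F} -> V} := poly_comb M.+1 w.
have phiA (p : {poly F}) : A (phi p) = phi (raise_poly M ('X - 0%:P) p).
  rewrite /phi /= /poly_comb linear_sum big_ord_recr big_ord_recl /= subr0.
  rewrite linearZ /= Aw // subnn scale0r scaler0 addr0.
  rewrite coefXM eqxx scale0r add0r; apply: eq_bigr => i _.
  rewrite linearZ /= Aw ?(ltnW (ltn_ord i)) // coefXM /= coefB coefMn coefXM coef_deriv scalerA.
  case: (val i) (ltn_ord i) => [|j] lt_jM /=; first by rewrite subn0 subr0 mulr_natr.
  by rewrite -mulrnBr ?(ltnW lt_jM) // mulr_natr.
have phiB (p : {poly F}) : (size p <= M.+1)%N -> B (phi p) = - phi p^`().
  move=> sp; rewrite /phi /= /poly_comb linear_sum big_ord_recl big_ord_recr /=.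
  rewrite coef_deriv (nth_default _ sp) mul0rn scale0r addr0 linearZ /= Bw0 scaler0 add0r.
  rewrite -sumrN; apply: eq_bigr => i _.
  by rewrite linearZ /= Bw // coef_deriv /bump /=; vring.
(* The action of C is determined by those of A and B. *)
have phiC (p : {poly F}) : (size p <= M.+1)%N -> C (phi p) = phi (raise_poly M ('X - (-1)%:P) p).
  move=> sp.
  have -> : C (phi p) = A (B (phi p)) - B (A (phi p)) + A (phi p) + B (phi p).
    by have [-> _ _] := triABC (phi p); vring.
  have sp' : (size p^`() <= M.+1)%N.
    by apply: leq_trans (leq_trans (leq_pred _) sp); exact: size_poly.
  have -> : raise_poly M ('X - (-1)%:P) p =
      - raise_poly M ('X - 0%:P) p^`() + (raise_poly M ('X - 0%:P) p)^`()
      + raise_poly M ('X - 0%:P) p - p^`().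
    rewrite /raise_poly !polyCN !polyC1 !polyC0 !(derivM, derivB, derivMn, derivX, derivC).
    ring.
  rewrite phiB // linearN /= !phiA phiB ?size_raise_poly //.
  by rewrite !linearD !linearN /= opprK.
have phi_inj (p : {poly F}) : (size p <= M.+1)%N -> phi p = 0 -> p = 0.
  elim: {p}(size p) {-2}p (leqnn (size p)) => [|n IHn] p sp spM phip.
    by apply/eqP; rewrite -size_poly_leq0.
  have p'0 : p^`() = 0.
    have sp' : (size p^`() <= (size p).-1)%N by exact: size_poly.
    apply: IHn; first by apply: leq_trans sp' _; rewrite -subn1 leq_subLR add1n.
      exact: leq_trans sp' (leq_trans (leq_pred _) spM).
    by apply/eqP; rewrite -oppr_eq0 -phiB // phip linear0.
  have pC : p = (p`_0)%:P.
    apply/polyP => -[|i]; rewrite coefC //=.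
    have := congr1 (fun q : {poly F} => q`_i) p'0; rewrite coef_deriv coef0 -mulr_natr => /eqP.
    by rewrite mulf_eq0 natF0 orbF => /eqP.
  move: phip; rewrite pC /phi /= /poly_comb big_ord_recl big1 => [|i _]; last first.
    by rewrite coefC scale0r.
  by rewrite addr0 coefC eqxx => /eqP; rewrite scaler_eq0 (negPf w0) orbF => /eqP ->.
pose X := [tuple w i | i < M.+1].
have Xi (i : 'I_M.+1) : X`_i = w i by rewrite (nth_mktuple _ _ i).
have inX i : (i <= M)%N -> (w i \in <<X>>)%VS.
  by move=> le_iM; rewrite memv_span // -(Xi (Ordinal (le_iM : i < M.+1)%N)) mem_nth // size_tuple.
have spanX : <<X>>%VS = {:V}%VS.
  have [||X0 | //] := @irrAB <<X>>%VS.
  - rewrite limg_span; apply/span_subvP => _ /mapP[_ /mapP[i _ ->] ->].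
    rewrite Aw -1?ltnS ?ltn_ord //; have := ltn_ord i.
    rewrite ltnS leq_eqVlt => /predU1P[-> | lt_iM]; first by rewrite subnn scale0r mem0v.
    by rewrite memvZ // inX.
  - rewrite limg_span; apply/span_subvP => _ /mapP[_ /mapP[i _ ->] ->].
    case: (val i) (ltn_ord i) => [|j] lt_j; first by rewrite Bw0 mem0v.
    by rewrite Bw // memvN memvZ // inX // ltnW.
  by have := inX 0%N isT; rewrite X0 memv0 (negPf w0).
have phi_surj u : exists2 p : {poly F}, (size p <= M.+1)%N & u = phi p.
  have /coord_span def_u : (u \in <<X>>)%VS by rewrite spanX memvf.
  exists (\poly_(i < M.+1) coord X (inord i) u); first exact: size_poly.
  rewrite {1}def_u /phi /= /poly_comb; apply: eq_bigr => i _.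
  by rewrite coef_poly ltn_ord inord_val Xi.
have freeX : free X.
  apply/freeP => k k0 i.
  have /phi_inj : (size (\poly_(i < M.+1) k (inord i)) <= M.+1)%N by exact: size_poly.
  have -> : phi (\poly_(i < M.+1) k (inord i)) = 0.
    rewrite -[RHS]k0 /phi /= /poly_comb; apply: eq_bigr => j _.
    by rewrite coef_poly ltn_ord inord_val Xi.
  move=> /(_ erefl)/polyP/(_ i).
  by rewrite coef_poly ltn_ord inord_val coef0.
have eqMN : M = N.
  by apply: succn_inj; rewrite -dimV -spanX (eqnP freeX) size_tuple.
by rewrite -eqMN; exists phi; split=> // p sp; split=> //; [exact: phiB | exact: phiC].
Qed.

End Model.

(** * Totally opposite filtrations *)

Section Cells.
Variables (F : fieldType) (V : vectType F) (N : nat).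

(** A flag read downwards and continued by its zero term, so that
    P k plays the role of U_(N - k). *)
Definition filtration (P : nat -> {vspace V}) : Prop :=
  (forall j k, (j <= k)%N -> (P k <= P j)%VS) /\
  (forall k, (k <= N.+1)%N -> \dim (P k) = (N.+1 - k)%N).

Lemma filtration_flag P : filtration P -> is_flag (fun i : 'I_N.+1 => P (N - i)%N).
Proof.
case=> decrP dimP; split=> [i | i j def_j]; last by apply: decrP; lia.
by have := ltn_ord i; rewrite dimP; lia.
Qed.

(** In a vanishing sum of vectors of the B i, the nonzero term of lowest height
    h i would be the opposite of a sum lying one step further down the
    filtration, which B i meets trivially. *)
Lemma directv_of_filtration (I : finType) (L : {set I}) (B : I -> {vspace V})
    (h : I -> nat) (P : nat -> {vspace V}) :
    {in L &, injective h} ->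
    (forall j k, (j <= k)%N -> (P k <= P j)%VS) ->
    (forall i, i \in L -> (B i <= P (h i))%VS) ->
    (forall i, i \in L -> (B i :&: P (h i).+1 = 0)%VS) ->
  directv (\sum_(i in L) B i)%VS.
Proof.
move=> h_inj decrP BP BP0; apply/directv_sum_independent => us us_B us0 i0 Li0.
apply/eqP; apply: contraTT (eqxx (0 : V)) => nz_i0.
pose Q i := (i \in L) && (us i != 0).
have Qi0 : Q i0 by rewrite /Q Li0.
case: (arg_minnP h Qi0) => i /andP[Li nz_i] min_i.
suff : us i \in (B i :&: P (h i).+1)%VS by rewrite BP0 // memv0 (negPf nz_i).
rewrite memv_cap us_B //=.
move: us0; rewrite (bigD1 i) //= => /eqP; rewrite addr_eq0 => /eqP ->.
rewrite memvN; apply: memv_suml => j /andP[Lj ne_ji].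
have [-> | nz_j] := eqVneq (us j) 0; first exact: mem0v.
apply: (subvP (decrP (h i).+1 (h j) _)); last exact: (subvP (BP j Lj)) _ (us_B j Lj).
rewrite ltn_neqAle min_i ?/Q ?Lj // andbT.
by apply: contraNneq ne_ji => /h_inj ->.
Qed.

Lemma dim_cap_ge (U W : {vspace V}) : \dim {:V} = N.+1 ->
  (\dim U + \dim W <= \dim (U :&: W) + N.+1)%N.
Proof. by move=> <-; rewrite -dimv_sum_cap addnC leq_add2l dimvS ?subvf. Qed.

Variables P Q R : nat -> {vspace V}.
Hypotheses (fP : filtration P) (fQ : filtration Q) (fR : filtration R).
Hypothesis opp : forall r s t, (N < r + s + t)%N -> (P r :&: Q s :&: R t = 0)%VS.

Variable cell : location N -> {vspace V}.
Hypothesis cellE : forall l, cell l = (P (loc1 l) :&: Q (loc2 l) :&: R (loc3 l))%VS.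

Lemma loc_sum (l : location N) : (loc1 l + loc2 l + loc3 l = N)%N.
Proof. exact/eqP/(valP l). Qed.

Lemma loc_eq (l m : location N) :
  loc1 l = loc1 m -> loc2 l = loc2 m -> loc3 l = loc3 m -> l = m.
Proof.
rewrite /loc1 /loc2 /loc3 => e1 e2 e3; apply: val_inj.
by move: e1 e2 e3; case: (val l) => [[? ?] ?]; case: (val m) => [[? ?] ?] /= -> -> ->.
Qed.

Lemma cell_capP l : (cell l :&: P (loc1 l).+1 = 0)%VS.
Proof.
apply/eqP; rewrite -subv0 -(opp (r := (loc1 l).+1) (s := loc2 l) (t := loc3 l)).
  by apply/subvP => u; rewrite cellE !memv_cap => /andP[/andP[/andP[_ ->] ->] ->].
by rewrite !addSn loc_sum.
Qed.

Lemma cell_capQ l : (cell l :&: Q (loc2 l).+1 = 0)%VS.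
Proof.
apply/eqP; rewrite -subv0 -(opp (r := loc1 l) (s := (loc2 l).+1) (t := loc3 l)).
  by apply/subvP => u; rewrite cellE !memv_cap => /andP[/andP[/andP[-> _] ->] ->].
by rewrite addnS addSn loc_sum.
Qed.

(** On a line one coordinate is fixed, so a second one determines the location
    and can serve as the height. *)
Lemma cell_line L : is_line L -> directv (\sum_(l in L) cell l)%VS.
Proof.
have subP l : (cell l <= P (loc1 l))%VS by rewrite cellE -capvA capvSl.
have subQ l : (cell l <= Q (loc2 l))%VS by rewrite cellE (capvC (P _)) -capvA capvSl.
case=> k [] ->.
- apply: (@directv_of_filtration _ _ _ (@loc2 N) Q) => //; last 2 first.
  + exact: fQ.1.
  + by move=> *; apply: cell_capQ.
  move=> l m; rewrite !inE => /eqP lk /eqP mk /val_inj e2.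
  apply: loc_eq => //; first by rewrite lk mk.
  by apply: val_inj => /=; have := loc_sum l; have := loc_sum m; rewrite lk mk e2; lia.
- apply: (@directv_of_filtration _ _ _ (@loc1 N) P) => //; last 2 first.
  + exact: fP.1.
  + by move=> *; apply: cell_capP.
  move=> l m; rewrite !inE => /eqP lk /eqP mk /val_inj e2.
  apply: loc_eq => //; first by rewrite lk mk.
  by apply: val_inj => /=; have := loc_sum l; have := loc_sum m; rewrite lk mk e2; lia.
- apply: (@directv_of_filtration _ _ _ (@loc1 N) P) => //; last 2 first.
  + exact: fP.1.
  + by move=> *; apply: cell_capP.
  move=> l m; rewrite !inE => /eqP lk /eqP mk /val_inj e2.
  apply: loc_eq => //; last by rewrite lk mk.
  by apply: val_inj => /=; have := loc_sum l; have := loc_sum m; rewrite lk mk e2; lia.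
Qed.

(** At most 1, as the cell meets trivially a hyperplane of P (loc1 l); at
    least 1, as the three spaces have codimensions of total N. *)
Lemma dim_cell (dimV : \dim {:V} = N.+1) l : \dim (cell l) = 1%N.
Proof.
have sum_l := loc_sum l; apply/eqP; rewrite eqn_leq; apply/andP; split.
  have /dimvS : (cell l + P (loc1 l).+1 <= P (loc1 l))%VS.
    by rewrite subv_add {1}cellE -capvA capvSl fP.1.
  rewrite dimv_disjoint_sum ?cell_capP // !fP.2 ?ltnS; lia.
have := dim_cap_ge (P (loc1 l)) (Q (loc2 l)) dimV.
have := dim_cap_ge (P (loc1 l) :&: Q (loc2 l))%VS (R (loc3 l)) dimV.
rewrite -cellE fP.2 ?fQ.2 ?fR.2; lia.
Qed.

(** The coordinatewise maximum of two distinct locations has total more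
    than N. *)
Lemma cell_disjoint l m : l != m -> (cell l :&: cell m = 0)%VS.
Proof.
move=> ne_lm; apply/eqP; rewrite -subv0.
rewrite -(opp (r := maxn (loc1 l) (loc1 m)) (s := maxn (loc2 l) (loc2 m))
              (t := maxn (loc3 l) (loc3 m))).
  apply/subvP => u; rewrite !cellE !memv_cap.
  case/and3P=> /andP[/andP[? ?] ?] /andP[? ?] ?.
  by rewrite /maxn; do 3!case: ifP => _; apply/andP; split=> //; apply/andP; split.
have := loc_sum l; have := loc_sum m => sm sl.
rewrite ltnNge; apply: contra ne_lm => le_N; apply/eqP.
by apply: loc_eq; apply: val_inj => /=; lia.
Qed.

End Cells.

(** * Billiard Arrays generated by vectors that sum to zero on black cliques *)

Section Triangles.
Variable T : finType.
Implicit Types x y z : T.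

Lemma mem_set3 x y z : [set x; y; z] =i [:: x; y; z].
Proof. by move=> w; rewrite !inE -orbA. Qed.

Lemma uniq_set3 x y z x' y' z' :
  [set x; y; z] = [set x'; y'; z'] -> uniq [:: x'; y'; z'] -> uniq [:: x; y; z].
Proof.
move=> eqC /card_uniqP card3; apply/card_uniqP.
by rewrite -(eq_card (mem_set3 x y z)) eqC (eq_card (mem_set3 x' y' z')).
Qed.

Lemma sum_set3 (U : zmodType) (b : T -> U) x y z :
  uniq [:: x; y; z] -> \sum_(i in [set x; y; z]) b i = b x + b y + b z.
Proof.
move=> Uxyz; rewrite (eq_bigl _ _ (mem_set3 x y z)) -big_uniq //=.
by rewrite !big_cons big_nil addr0 addrA.
Qed.

End Triangles.

Section Cliques.
Variables (F : fieldType) (V : vectType F) (N : nat).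
Variables (B : location N -> {vspace V}) (b : location N -> V).
Hypothesis B_line : forall l, B l = <[b l]>%VS.
Hypothesis b_neq0 : forall l, b l != 0.
Hypothesis B_disjoint : forall l m, l != m -> (B l :&: B m = 0)%VS.
Hypothesis b_black : forall l m n r s t,
  at_loc l r.+1 s t -> at_loc m r s.+1 t -> at_loc n r s t.+1 ->
  b l + b m + b n = 0.

Lemma black_clique_uniq (l m n : location N) :
  black_clique [set l; m; n] -> uniq [:: l; m; n].
Proof.
case=> x [y [z [eqC [r [s [t [[x1 x2 x3] [y1 y2 y3] [z1 z2 z3]]]]]]]].
apply: uniq_set3 eqC _; rewrite /= !inE negb_or !andbT.
by apply/andP; split; first apply/andP; try split; apply/eqP => e; subst; lia.
Qed.

Lemma black_clique_sum C : black_clique C -> \sum_(l in C) b l = 0.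
Proof.
move=> bC; have [x [y [z [eqC [r [s [t [hx hy hz]]]]]]]] := bC.
rewrite eqC sum_set3; first exact: b_black hx hy hz.
by apply: black_clique_uniq; rewrite -eqC.
Qed.

Lemma black_clique_sum3 (l m n : location N) :
  black_clique [set l; m; n] -> b l + b m + b n = 0.
Proof.
by move=> bC; rewrite -sum_set3 ?black_clique_sum ?black_clique_uniq.
Qed.

Lemma black_clique_not_direct C : black_clique C -> ~~ directv (\sum_(l in C) B l)%VS.
Proof.
move=> bC; apply/negP => /directv_sum_independent/(_ b) b0.
have [x [y [z [eqC _]]]] := bC.
have /negP[] := b_neq0 x; apply/eqP/b0; last by rewrite eqC !inE eqxx.
  by move=> l _; rewrite B_line memv_line.
exact: black_clique_sum.
Qed.

Lemma b_mem l : b l \in B l.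
Proof. by rewrite B_line memv_line. Qed.

Lemma mem_B_line l u : u \in B l -> exists k, u = k *: b l.
Proof. by rewrite B_line => /vlineP. Qed.

Definition gen l : subvs_of (B l) := Subvs (b_mem l).

Lemma gen_neq0 l : gen l != 0.
Proof. by rewrite -(inj_eq val_inj) /= b_neq0. Qed.

Lemma gen_scale l (u : subvs_of (B l)) : exists k, u = k *: gen l.
Proof.
have [k u_k] := mem_B_line (subvsP u); by exists k; apply: val_inj; exact: u_k.
Qed.

(** Since b l + b m + b n = 0, the map sending b l to b m qualifies. Conversely
    b l + c b m lies on the line of b n = - (b l + b m) only for c = 1, as b l
    and b m are independent. *)
Lemma tilde_gen l m n : black_clique [set l; m; n] -> tilde B l m (gen l) = gen m.
Proof.
move=> bC.
have [n' bC' tildeP] : tilde_spec (tilde B l m).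
  rewrite /tilde; apply: epsilon_spec.
  (* The coordinate of u along b l, placed along b m. *)
  pose g (u : subvs_of (B l)) := coord [tuple b l] ord0 (vsval u) *: gen m.
  have lin_g : linear g.
    by move=> k u v; rewrite /g !linearP /= scalerDl scalerA.
  pose gl : {linear subvs_of (B l) -> subvs_of (B m)} :=
    HB.pack g (GRing.isLinear.Build _ _ _ _ g lin_g).
  have gE k : linfun gl (k *: gen l) = k *: gen m.
    have := @coord_free _ _ _ [tuple b l] ord0 ord0.
    rewrite seq1_free b_neq0 => /(_ isT) /= coord1.
    rewrite (lfunE gl) /= /g (_ : vsval (k *: gen l) = k *: b l) //.
    by rewrite linearZ /= coord1 mulr1.
  exists (linfun gl); exists n => // u.
  have [k ->] := gen_scale u; rewrite gE scaler_eq0 (negPf (gen_neq0 _)) orbF => k0.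
  rewrite scaler_eq0 (negPf (gen_neq0 _)) orbF; split=> //=.
  rewrite -scalerDr memvZ // -[_ + _]opprK memvN.
  have /eqP := black_clique_sum3 bC; rewrite addr_eq0 => /eqP ->.
  by rewrite opprK b_mem.
have [_] := tildeP _ (gen_neq0 l); have [c ->] := gen_scale (tilde B l m (gen l)).
move=> /mem_B_line[d /= lc].
have bn' : b n' = - (b l + b m).
  by apply/eqP; rewrite -addr_eq0 addrC; apply/eqP/black_clique_sum3.
have ne_lm : l != m.
  by have := black_clique_uniq bC; rewrite /= inE negb_or => /andP[/andP[]].
have rel : (1 + d) *: b l = - (c + d) *: b m.
  apply/eqP; rewrite -subr_eq0; apply/eqP; transitivity (b l + c *: b m - d *: b n').
    by rewrite bn'; vring.
  by rewrite lc subrr.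
have m0 : (c + d) *: b m = 0.
  apply/eqP; rewrite -memv0 -(B_disjoint ne_lm) memv_cap [X in _ && X]memvZ ?b_mem // andbT.
  by rewrite -[c + d]opprK scaleNr -rel memvN memvZ ?b_mem.
have l0 : (1 + d) *: b l = 0 by rewrite rel scaleNr m0 oppr0.
move/eqP: m0; move/eqP: l0; rewrite !scaler_eq0 !(negPf (b_neq0 _)) !orbF.
by rewrite addrC addr_eq0 => /eqP ->; rewrite subr_eq0 => /eqP ->; rewrite scale1r.
Qed.

Lemma loc_exists r s t : (r + s + t = N)%N -> exists l : location N, at_loc l r s t.
Proof.
move=> rst.
have hr : (r < N.+1)%N by lia.
have hs : (s < N.+1)%N by lia.
have ht : (t < N.+1)%N by lia.
have ok : ((Ordinal hr, Ordinal hs, Ordinal ht).1.1 + (Ordinal hr, Ordinal hs, Ordinal ht).1.2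
           + (Ordinal hr, Ordinal hs, Ordinal ht).2 == N)%N by apply/eqP.
by exists (exist _ (Ordinal hr, Ordinal hs, Ordinal ht) ok).
Qed.

(** The three maps send b l to b m, b m to b n and b n back to b l. *)
Lemma clique_value1 l m n : white_clique l m n -> clique_value B l m n = 1.
Proof.
case=> r [s [t [hl hm hn]]].
have total : (r.+1 + s.+1 + t = N)%N.
  by have [<- <- <-] := hn; exact: loc_sum.
(* The third vertices of the black cliques on the sides of the white one. *)
have [i hi] := @loc_exists r s t.+2 ltac:(lia).
have [j hj] := @loc_exists r.+2 s t ltac:(lia).
have [k hk] := @loc_exists r s.+2 t ltac:(lia).
have lm : tilde B l m (gen l) = gen m.
  apply: (@tilde_gen _ _ i); exists m, l, i; split; last by exists r, s, t.+1.
  by rewrite (setUC [set l]).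
have mn : tilde B m n (gen m) = gen n.
  apply: (@tilde_gen _ _ j); exists j, n, m; split; last by exists r.+1, s, t.
  by rewrite setUC (setUC [set m]) setUA.
have nl : tilde B n l (gen n) = gen l.
  apply: (@tilde_gen _ _ k); exists n, k, l; split; last by exists r, s.+1, t.
  by rewrite -!setUA (setUC [set l]).
have compE : (tilde B n l \o tilde B m n \o tilde B l m)%VF = \1%VF.
  apply/lfunP => u; have [c ->] := gen_scale u.
  by rewrite !comp_lfunE !linearZ /= id_lfunE lm mn nl.
rewrite /clique_value compE.
have := epsilon_spec (inhabits 0) (fun a : F => \1%VF = a *: \1%VF :> 'End(subvs_of (B l))).
set a := epsilon _ _ => /(_ (ex_intro _ 1 _)) -/(_ (esym (scale1r _))).
move=> /lfunP/(_ (gen l)); rewrite scale_lfunE id_lfunE => /eqP.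
rewrite -[X in X == _]scale1r -subr_eq0 -scalerBl scaler_eq0 (negPf (gen_neq0 _)) orbF.
by rewrite subr_eq0 => /eqP.
Qed.

End Cliques.

(** * The three flags in the polynomial model *)

Lemma size_derivn_leq (R : nzRingType) (p : {poly R}) k : (size p^`(k) <= size p - k)%N.
Proof.
elim: k => [|k IHk]; first by rewrite subn0.
by rewrite derivnS subnS (leq_trans (size_poly _ _)) // -!subn1 leq_sub2r.
Qed.

Section PolynomialCoordinates.
Variables (F : fieldType) (V : vectType F) (N : nat).
Variable phi : {linear {poly F} -> V}.
Hypothesis charF0 : [pchar F] =i pred0.
Hypothesis phi_inj : forall p : {poly F}, (size p <= N.+1)%N -> phi p = 0 -> p = 0.
Hypothesis phi_surj : forall u, exists2 p : {poly F}, (size p <= N.+1)%N & u = phi p.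

Lemma deriv_XsubC (a : F) : ('X - a%:P)^`() = 1.
Proof. by rewrite derivB derivX derivC subr0. Qed.

Lemma phi_neq0 (p : {poly F}) : (size p <= N.+1)%N -> p != 0 -> phi p != 0.
Proof. by move=> sp; apply: contraNneq => /phi_inj ->. Qed.

Lemma phi_eq (p q : {poly F}) : (size p <= N.+1)%N -> (size q <= N.+1)%N ->
  phi p = phi q -> p = q.
Proof.
move=> sp sq eq_pq; apply/eqP; rewrite -subr_eq0; apply/eqP/phi_inj.
  by rewrite (leq_trans (size_polyD _ _)) // geq_max sp size_polyN.
by rewrite linearB /= eq_pq subrr.
Qed.

Section Raising.
Variables (f : 'End(V)) (a : F).
Hypothesis f_raise : forall p : {poly F}, (size p <= N.+1)%N ->
  f (phi p) = phi (raise_poly N ('X - a%:P) p).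

Lemma raise_limg k u : u \in limg (lfun_pow f k) ->
  exists p : {poly F}, [/\ (size p <= N.+1)%N, ('X - a%:P) ^+ k %| p & u = phi p].
Proof.
case/memv_imgP => v _ ->; elim: k => [|k [p [sp dp fp]]].
  have [p sp ->] := phi_surj v; exists p.
  by rewrite lfun_pow0 expr0 dvd1p.
exists (raise_poly N ('X - a%:P) p); split; first exact: size_raise_poly.
  by rewrite raise_poly_dvd ?deriv_XsubC.
by rewrite lfun_powS fp f_raise.
Qed.

Lemma raise_filtration (dimV : \dim {:V} = N.+1) :
  filtration N (fun k => limg (lfun_pow f k)).
Proof.
split; first exact: limg_pow_leq.
apply: dim_limg_pow => //.
  apply/lfunP => v; rewrite zero_lfunE.
  have [p [sp dp ->]] := raise_limg (memv_img (lfun_pow f N.+1) (memvf v)).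
  have [-> | p0] := eqVneq p 0; first exact: linear0.
  by have := dvdp_leq p0 dp; rewrite size_exp_XsubC ltnNge sp.
have pow1 k : (k <= N)%N -> lfun_pow f k (phi 1) = (N ^_ k)%:R *: phi (('X - a%:P) ^+ k).
  elim: k => [|k IHk] lt_kN; first by rewrite lfun_pow0 scale1r expr0.
  rewrite lfun_powS IHk ?(ltnW lt_kN) // linearZ /= f_raise; last by rewrite size_exp_XsubC ltnW.
  rewrite raise_poly_exp ?deriv_XsubC ?(ltnW lt_kN) // -scaler_nat linearZ /= scalerA.
  by rewrite -natrM ffactnSr.
(* f^N takes 1 to a nonzero multiple of ('X - a)^N. *)
apply: contraTneq (phi_neq0 (p := ('X - a%:P) ^+ N) _ _); last 2 first.
- by rewrite size_exp_XsubC.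
- by rewrite expf_neq0 // polyXsubC_eq0.
move=> f0; have := pow1 N (leqnn _); rewrite f0 zero_lfunE => /esym/eqP.
by rewrite scaler_eq0 (natf_eq0 charF0) ffactnn -leqn0 leqNgt fact_gt0 /= => /eqP->; rewrite eqxx.
Qed.

End Raising.

Section Lowering.
Variable f : 'End(V).
Hypothesis f_lower : forall p : {poly F}, (size p <= N.+1)%N -> f (phi p) = - phi p^`().

Lemma lower_pow k (p : {poly F}) : (size p <= N.+1)%N ->
  lfun_pow f k (phi p) = (-1) ^+ k *: phi p^`(k).
Proof.
move=> sp; elim: k => [|k IHk]; first by rewrite lfun_pow0 scale1r.
rewrite lfun_powS IHk linearZ /= f_lower ?derivnS ?exprS; last first.
  exact: leq_trans (size_derivn_leq _ _) (leq_trans (leq_subr _ _) sp).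
by vring.
Qed.

Lemma lower_limg k u : u \in limg (lfun_pow f k) ->
  exists2 p : {poly F}, (size p <= N.+1 - k)%N & u = phi p.
Proof.
case/memv_imgP => v _ ->; have [p sp ->] := phi_surj v.
exists ((-1) ^+ k *: p^`(k)); last by rewrite lower_pow // linearZ.
by apply: leq_trans (size_scale_leq _ _) (leq_trans (size_derivn_leq _ _) _); rewrite leq_sub2r.
Qed.

Lemma lower_filtration (dimV : \dim {:V} = N.+1) :
  filtration N (fun k => limg (lfun_pow f k)).
Proof.
split; first exact: limg_pow_leq.
apply: dim_limg_pow => //.
  apply/lfunP => v; rewrite zero_lfunE.
  have [p] := lower_limg (memv_img (lfun_pow f N.+1) (memvf v)).
  by rewrite subnn size_poly_leq0 => /eqP -> ->; rewrite linear0.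
(* f^N takes 'X^N to a nonzero constant. *)
apply: contraTneq (phi_neq0 (p := 1) _ (oner_neq0 _)) => [f0|]; last by rewrite size_poly1.
have := lower_pow N (p := 'X^N); rewrite size_polyXn leqnn => /(_ isT).
rewrite f0 zero_lfunE derivnXn subnn expr0 ffactnn -scaler_nat linearZ /= scalerA => /esym/eqP.
rewrite scaler_eq0 mulf_eq0 signr_eq0 (natf_eq0 charF0) -leqn0 leqNgt fact_gt0 /= => /eqP->.
by rewrite eqxx.
Qed.

End Lowering.

End PolynomialCoordinates.

Section ModelCells.
Variables (F : fieldType) (V : vectType F) (N : nat) (A B C : 'End(V)).
Variable phi : {linear {poly F} -> V}.
Hypothesis charF0 : [pchar F] =i pred0.
Hypothesis model : polynomial_model N A B C phi.

Let phi_inj : forall p : {poly F}, (size p <= N.+1)%N -> phi p = 0 -> p = 0.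
Proof. by have [] := model. Qed.

Let phi_surj : forall u, exists2 p : {poly F}, (size p <= N.+1)%N & u = phi p.
Proof. by have [] := model. Qed.

Let phi_A (p : {poly F}) : (size p <= N.+1)%N ->
  A (phi p) = phi (raise_poly N ('X - 0%:P) p).
Proof. by have [_ _ act] := model; case/act. Qed.

Let phi_B (p : {poly F}) : (size p <= N.+1)%N -> B (phi p) = - phi p^`().
Proof. by have [_ _ act] := model; case/act. Qed.

Let phi_C (p : {poly F}) : (size p <= N.+1)%N ->
  C (phi p) = phi (raise_poly N ('X - (-1)%:P) p).
Proof. by have [_ _ act] := model; case/act. Qed.

Local Notation P := (fun k => limg (lfun_pow A k)).
Local Notation Q := (fun k => limg (lfun_pow B k)).
Local Notation R := (fun k => limg (lfun_pow C k)).

(** Up to sign, the binary form x^r y^s z^t for any s. *)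
Definition cell_poly r t : {poly F} := ('X - 0%:P) ^+ r * ('X - (-1)%:P) ^+ t.

Lemma size_cell_poly r t : size (cell_poly r t) = (r + t).+1.
Proof.
by rewrite size_Mmonic ?monic_exp ?monicXsubC ?expf_neq0 ?polyXsubC_eq0 // !size_exp_XsubC addSn addnS.
Qed.

(** The bound on the size records the divisibility by y^s, where y = 1. *)
Lemma mem_cellP r s t u : u \in (P r :&: Q s :&: R t)%VS ->
  exists p : {poly F}, [/\ (size p <= N.+1 - s)%N, cell_poly r t %| p & u = phi p].
Proof.
rewrite !memv_cap => /andP[/andP[]].
move=> /(raise_limg phi_surj phi_A)[p [sp dp ->]] /(lower_limg phi_surj phi_B)[q sq eq_q].
have sq' := leq_trans sq (leq_subr _ _).
move=> /(raise_limg phi_surj phi_C)[m [sm dm eq_m]].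
have eqpq := phi_eq phi_inj sp sq' eq_q; have eqpm := phi_eq phi_inj sp sm eq_m.
exists p; split=> //; first by rewrite eqpq.
rewrite Gauss_dvdp ?dp ?eqpm //.
rewrite coprimep_expl // coprimep_expr // coprimep_XsubC root_XsubC.
by rewrite oppr_eq0 oner_eq0.
Qed.

Lemma model_opposite r s t : (N < r + s + t)%N -> (P r :&: Q s :&: R t = 0)%VS.
Proof.
move=> gtN; apply/eqP; rewrite -subv0; apply/subvP => u /mem_cellP[p [sp dp ->]].
have [-> | p0] := eqVneq p 0; first by rewrite linear0 mem0v.
by have := leq_trans (dvdp_leq p0 dp) sp; rewrite size_cell_poly; lia.
Qed.

(** The form x^r y^s z^t with x = X, y = 1, z = - (X + 1). Unlike in
    [cell_poly], the sign matters: it makes the black clique relation the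
    product of a form with x + y + z = 0. *)
Definition monomial (l : location N) : {poly F} :=
  'X ^+ loc1 l * (- ('X + 1)) ^+ loc3 l.

Lemma monomialE l : monomial l = (-1) ^+ loc3 l *: cell_poly (loc1 l) (loc3 l).
Proof.
rewrite /monomial /cell_poly polyCN !polyC1 polyC0 subr0 opprK.
by rewrite -[- _]scaleN1r exprZn scalerAr.
Qed.

Lemma phi_monomial_neq0 l : phi (monomial l) != 0.
Proof.
rewrite monomialE linearZ scaler_eq0 signr_eq0 /=; apply: (phi_neq0 phi_inj).
  by rewrite size_cell_poly ltnS; have := loc_sum l; lia.
by rewrite -size_poly_eq0 size_cell_poly.
Qed.

Lemma filtrations_of_model (dimV : \dim {:V} = N.+1) :
  [/\ filtration N P, filtration N Q & filtration N R].
Proof.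
split;
  [ exact: (raise_filtration charF0 phi_inj phi_surj phi_A dimV)
  | exact: (lower_filtration charF0 phi_inj phi_surj phi_B dimV)
  | exact: (raise_filtration charF0 phi_inj phi_surj phi_C dimV)].
Qed.

Variable cell : location N -> {vspace V}.
Hypothesis cellE : forall l, cell l = (P (loc1 l) :&: Q (loc2 l) :&: R (loc3 l))%VS.

(** The cell is a line, and a nonzero vector of it comes from a multiple of
    x^r z^t of degree at most N - s = r + t, hence from a scalar multiple. *)
Lemma cell_line_monomial (dimV : \dim {:V} = N.+1) l : cell l = <[phi (monomial l)]>%VS.
Proof.
have [fP fQ fR] := filtrations_of_model dimV.
have dim1 := dim_cell fP fQ fR model_opposite cellE dimV l.
have u0 : vpick (cell l) != 0 by rewrite vpick0 -dimv_eq0 dim1.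
have := memv_pick (cell l); rewrite {2}cellE => /mem_cellP[p [sp /dvdpP[q def_p] eq_u]].
apply/esym/eqP; rewrite eqEdim dim1 dim_vline phi_monomial_neq0 andbT.
have q0 : q != 0 by apply: contraNneq u0 => q0; rewrite eq_u def_p q0 mul0r linear0.
have sq : (size q <= 1)%N.
  move: sp; rewrite def_p size_mul // -?size_poly_eq0 size_cell_poly //.
  have := loc_sum l; move: (size q) (nat_of_ord (loc1 l)) (nat_of_ord (loc2 l)) (nat_of_ord (loc3 l)).
  by lia.
have def_q := size1_polyC sq.
have q00 : q`_0 != 0 by apply: contraNneq q0 => e; rewrite def_q e.
rewrite -memvE monomialE linearZ /= memvZ //.
have -> : phi (cell_poly (loc1 l) (loc3 l)) = (q`_0)^-1 *: vpick (cell l).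
  by rewrite eq_u def_p def_q mul_polyC coefC linearZ /= scalerA mulVf ?scale1r.
by rewrite memvZ ?memv_pick.
Qed.

Lemma monomial_black l m n r s t :
    at_loc l r.+1 s t -> at_loc m r s.+1 t -> at_loc n r s t.+1 ->
  phi (monomial l) + phi (monomial m) + phi (monomial n) = 0.
Proof.
case=> l1 _ l3 [m1 _ m3] [n1 _ n3]; rewrite -!linearD /monomial l1 l3 m1 m3 n1 n3.
by rewrite -(linear0 phi); congr (phi _); rewrite !exprS; ring.
Qed.

End ModelCells.

(** * The triple nu_x, nu_y, nu_z of an irreducible module *)

Section FromLieAlgebra.
Variables (F : fieldType) (charF0 : [pchar F] =i pred0).
Variables (V : vectType F) (rho : {linear sl2 F -> 'End(V)}).
Hypotheses (rhoM : sl2_module rho) (rhoI : sl2_irreducible rho).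

Lemma nu_bracket :
  [/\ sl2_bracket nu_x nu_y = nu_z - nu_x - nu_y :> sl2 F,
      sl2_bracket nu_y nu_z = nu_x - nu_y - nu_z :> sl2 F
    & sl2_bracket nu_z nu_x = nu_y - nu_z - nu_x :> sl2 F].
Proof.
have two0 : 2 != 0 :> F by rewrite (natf_eq0 charF0).
by split; apply/rowP => i; rewrite !mxE /=; field; rewrite ?oppr_eq0 two0.
Qed.

Lemma nu_equitable : equitable_triple (rho nu_x) (rho nu_y) (rho nu_z).
Proof.
have [xy yz zx] := nu_bracket; move=> u.
have E a b : rho a (rho b u) - rho b (rho a u) = rho (sl2_bracket a b) u.
  by rewrite rhoM add_lfunE opp_lfunE !comp_lfunE.
by rewrite !E xy yz zx !(linearD, linearN) /= !add_lfunE !opp_lfunE.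
Qed.

Lemma nu_irreducible : no_invariant_subspace (rho nu_x) (rho nu_y).
Proof.
move=> W Wx Wy; apply: rhoI.2 => a.
have memx u : u \in W -> rho nu_x u \in W by move=> Wu; rewrite (subvP Wx) ?memv_img.
have memy u : u \in W -> rho nu_y u \in W by move=> Wu; rewrite (subvP Wy) ?memv_img.
have memz u : u \in W -> rho nu_z u \in W.
  move=> Wu; have [xy _ _] := nu_equitable u.
  have -> : rho nu_z u = rho nu_x (rho nu_y u) - rho nu_y (rho nu_x u) + rho nu_x u + rho nu_y u.
    by rewrite xy; vring.
  by rewrite !memvD ?memvN ?memx ?memy ?memx.
(* Coordinates in the basis nu_x, nu_y, nu_z, from x = nu_x - nu_y - nu_z and
   its cyclic images. *)
have -> : a = (a 0 0 - a 0 1 - a 0 2) *: nu_x + (a 0 1 - a 0 0 - a 0 2) *: nu_y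
              + (a 0 2 - a 0 0 - a 0 1) *: nu_z.
  have two0 : 2 != 0 :> F by rewrite (natf_eq0 charF0).
  apply/rowP => i; rewrite !mxE /=.
  case: i => [[|[|[|//]]]] Hi.
  - rewrite (_ : Ordinal Hi = 0) /=; last exact: val_inj.
    by field; rewrite ?oppr_eq0 two0.
  - rewrite (_ : Ordinal Hi = 1) /=; last exact: val_inj.
    by field; rewrite ?oppr_eq0 two0.
  - rewrite (_ : Ordinal Hi = 2) /=; last exact: val_inj.
    by field; rewrite ?oppr_eq0 two0.
apply/subvP => _ /memv_imgP[u Wu ->].
have rhoE i j k x y z :
    rho (i *: x + j *: y + k *: z) u = i *: rho x u + j *: rho y u + k *: rho z u.
  by rewrite !linearD !linearZ /= !add_lfunE !scale_lfunE.
by rewrite rhoE !memvD ?memvZ ?memx ?memy ?memz.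
Qed.

End FromLieAlgebra.

Theorem corollary21p15 (F : fieldType) (charF0 : [pchar F] =i pred0)
    (N : nat) (V : vectType F) (dimV : \dim {:V} = N.+1)
    (rho : {linear sl2 F -> 'End(V)})
    (rhoM : sl2_module rho) (rhoI : sl2_irreducible rho) :
  let U := pow_image_seq N (rho nu_x) in
  let U' := pow_image_seq N (rho nu_y) in
  let U'' := pow_image_seq N (rho nu_z) in
  let B := array_of_flags U U' U'' in
  ([/\ is_flag U, is_flag U', is_flag U'' & totally_opposite U U' U'']) /\
  (billiard_array B /\
   forall l m n : location N, white_clique l m n -> clique_value B l m n = 1).
Proof.
move=> U U' U'' B.
have [phi model] := exists_polynomial_model charF0 (nu_equitable charF0 rhoM)
  (nu_irreducible charF0 rhoM rhoI) dimV.
have [fP fQ fR] := filtrations_of_model charF0 model dimV.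
have opp := model_opposite model.
have sub_rev (r : 'I_N.+1) : (N - rev_ord r = r)%N.
  by rewrite /= subSS subKn // -ltnS.
have BE l : B l = (limg (lfun_pow (rho nu_x) (loc1 l)) :&: limg (lfun_pow (rho nu_y) (loc2 l))
                   :&: limg (lfun_pow (rho nu_z) (loc3 l)))%VS.
  by rewrite /B /array_of_flags /U /U' /U'' /pow_image_seq !sub_rev.
have B_gen := cell_line_monomial charF0 model BE dimV.
have gen_neq0 := phi_monomial_neq0 model.
have gen_black := @monomial_black _ _ N phi.
have B_disj := cell_disjoint opp BE.
split; first split.
- exact: filtration_flag fP.
- exact: filtration_flag fQ.
- exact: filtration_flag fR.
- by move=> r s t gtN; rewrite /U /U' /U'' /pow_image_seq !sub_rev opp.
split; first split.
- exact: (dim_cell fP fQ fR opp BE dimV).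
- exact: (cell_line fP fQ opp BE).
- exact: (black_clique_not_direct B_gen gen_neq0 gen_black).
exact: (clique_value1 B_gen gen_neq0 B_disj gen_black).
Qed.
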